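(* Let $A_1,A_2\in\mathbb{R}^{3\times3}$ be Metzler matrices with zero row sums. The switched consensus system $$\dot x(t)=A_{\sigma(t)}x(t),\qquad x(0)=x_0\in\mathbb{R}^3,$$ with switching laws $\sigma:[0,\infty)\to\{1,2\}$, uniformly converges to consensus if and only if the digraph corresponding to every matrix in $\operatorname{co}[A_1,A_2]:=\{\alpha A_1+(1-\alpha)A_2:\alpha\in[0,1]\}$ contains a rooted-out branching as a subgraph.
   Context: A matrix is Metzler if its off-diagonal entries are nonnegative. A switching law is a piecewise constant function $\sigma:[0,\infty)\to\{1,2\}$ (finitely many discontinuities on every bounded interval). With $1_3$ the all-ones vector in $\mathbb{R}^3$, the system converges to consensus for $\sigma$ if $\lim_{t\to\infty}x(t,\sigma)=c1_3$ for some $c\in\mathbb{R}$; it uniformly converges to consensus (UCC) if it converges to consensus for every switching law and every $x_0\in\mathbb{R}^3$. The digraph corresponding to a Metzler matrix $A=(a_{ij})\in\mathbb{R}^{n\times n}$ with zero row sums has vertex set $\{1,\dots,n\}$ and a directed edge from node $i$ to node $j\ne i$ (with weight $a_{ji}$) if and only if $a_{ji}\ne0$. The digraph contains a rooted-out branching as a subgraph if it has a subgraph on all the vertices that contains no directed cycle and in which there is a vertex $v$ (the root) such that for every other vertex $p$ there is a directed path from $v$ to $p$. *)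

(* Defs.v *)
From HB Require Import structures.
From mathcomp Require Import all_boot all_order all_algebra.
From mathcomp Require Import all_classical all_reals all_analysis.

Set Implicit Arguments.
Unset Strict Implicit.
Unset Printing Implicit Defensive.

Import Order.TTheory GRing.Theory Num.Theory.
Import numFieldNormedType.Exports.

Local Open Scope classical_set_scope.
Local Open Scope ring_scope.

Definition metzler (R : realType) (n : nat) (A : 'M[R]_n) : Prop :=
  forall i j, i != j -> 0 <= A i j.

Definition zero_row_sums (R : realType) (n : nat) (A : 'M[R]_n) : Prop :=
  forall i, \sum_j A i j = 0.

(* The edge i -> j is read off the transposed entry A j i: in x' = A x, node j
   receives information from node i. *)
Definition digraph (R : realType) (n : nat) (A : 'M[R]_n) : rel 'I_n :=
  fun i j => (i != j) && (A j i != 0).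

(* [ucycle] holds of [::], which is not counted as a directed cycle. *)
Definition acyclic (T : finType) (e : rel T) : Prop :=
  forall c : seq T, ucycle e c -> c = [::].

Definition has_rooted_out_branching (T : finType) (e : rel T) : Prop :=
  exists b : rel T,
    [/\ subrel b e, acyclic b &
        exists v : T, forall p : T, p != v -> connect b v p].

Definition co (R : realType) (n : nat) (A1 A2 : 'M[R]_n) : set 'M[R]_n :=
  [set a *: A1 + (1 - a) *: A2 | a in `[0, 1]].

(* Modes 1 and 2 are encoded as [true] and [false]. *)
Definition mode (R : realType) (n : nat) (A1 A2 : 'M[R]_n) (b : bool) :
    'M[R]_n :=
  if b then A1 else A2.

(* A switching law lives on [0, +oo[, so continuity is relative to that set
   (one-sided at 0) and values at negative times are irrelevant; [bool] carries
   the discrete topology, so continuity at t means being constant near t. *)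
Definition switching_continuous_at (R : realType) (sigma : R -> bool) (t : R) :
    Prop :=
  sigma s @[s --> within `[0, +oo[ (nbhs t)] --> sigma t.

Definition switching_law (R : realType) (sigma : R -> bool) : Prop :=
  forall T : R, finite_set
    [set t | t \in `[0, T] /\ ~ switching_continuous_at sigma t].

(* A solution is continuous on [0, +oo[ and satisfies the differential equation
   at every positive time at which the switching law does not switch; such a
   function exists and is unique for every switching law and initial state. *)
Definition solution (R : realType) (n : nat) (A1 A2 : 'M[R]_n.+1)
    (sigma : R -> bool) (x0 : 'cV[R]_n.+1) (x : R -> 'cV[R]_n.+1) : Prop :=
  [/\ x 0 = x0,
      {within `[0, +oo[, continuous x} &
      forall t : R, 0 < t -> switching_continuous_at sigma t ->
        is_derive t 1 x (mode A1 A2 (sigma t) *m x t)].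

Definition reaches_consensus (R : realType) (n : nat)
    (x : R -> 'cV[R]_n.+1) : Prop :=
  exists c : R, x t @[t --> +oo] --> (const_mx c : 'cV[R]_n.+1).

Definition UCC (R : realType) (n : nat) (A1 A2 : 'M[R]_n.+1) : Prop :=
  forall sigma : R -> bool, switching_law sigma ->
  forall (x0 : 'cV[R]_n.+1) (x : R -> 'cV[R]_n.+1),
    solution A1 A2 sigma x0 x -> reaches_consensus x.

(* Main.v *)
(* The argument works in every dimension. Metzler matrices cannot cancel each
   other, so the digraph of an interior convex combination contains those of A1
   and A2, and the convex-hull condition only says that A1 and A2 both have a
   root.

   If the digraph of A_b has no root, two disjoint nonempty sets of nodes have
   no incoming edges. Each carries the support of a nonzero left null vector of
   A_b, so the kernel of A_b has dimension at least 2 and contains an equilibrium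
   that is not a consensus state.

   Conversely, let lo <= x <= hi at time s. The families x - lo and hi - x solve
   the same system and stay nonnegative. Say that a component of either family
   is large if it exceeds a threshold d <= (hi - lo) / 2; every node is large in
   at least one of the families. If neither family is large everywhere, then in
   each mode an edge leads from a large to a non-large component (start from the
   root). One of the two targets becomes large, for a smaller threshold, within
   one time unit, whatever the switching is. Hence after at most 2n + 1 time
   units one family is large everywhere, which shrinks hi - lo by a factor that
   does not depend on the switching law. *)

Require Import Defs.
From HB Require Import structures.
From mathcomp Require Import all_boot all_order all_algebra.
From mathcomp Require Import all_classical all_reals all_analysis.
From mathcomp Require Import ring lra.

Set Implicit Arguments.
Unset Strict Implicit.
Unset Printing Implicit Defensive.

Import Order.TTheory GRing.Theory Num.Theory.
Import numFieldNormedType.Exports.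

Local Open Scope classical_set_scope.
Local Open Scope ring_scope.

(** * Rooted digraphs *)

(** Given a root, keep only the edges that increase the distance [d] from it: [d] rules out cycles,
    and shortest paths survive. *)
Lemma has_rooted_out_branchingP (T : finType) (e : rel T) :
  has_rooted_out_branching e <-> exists v, forall p, connect e v p.
Proof.
split=> [[b [be _ [v bv]]]|[v ev]].
  exists v => p; have [->|/bv] := eqVneq p v; first exact: connect0.
  by apply: connect_sub => x y /be; exact: connect1.
have dist_ex p :
    exists k, `[< exists s, [/\ path e v s, last v s = p & size s = k] >].
  by case/connectP: (ev p) => s es ->; exists (size s); apply/asboolP; exists s.
pose d p := ex_minn (dist_ex p).
exists [rel x y | e x y && (d x < d y)%N]; split.
- by move=> x y /andP[].
- case=> // x c /andP[/= bc _].
  have trd : transitive (relpre d ltn) by move=> ? ? ?; exact: ltn_trans.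
  have /(order_path_min trd) : path (relpre d ltn) x (rcons c x).
    by apply: sub_path bc => y z /andP[].
  by move=> /allP/(_ x); rewrite mem_rcons mem_head /= ltnn => /(_ isT).
- exists v => p _; have [k] := ubnP (d p); elim: k p => // k IH p.
  have : exists s, [/\ path e v s, last v s = p & size s = d p].
    by rewrite /d; case: ex_minnP => m /asboolP.
  case=> s; case/lastP: s => [[_ <- _ _]|s q [+ + + dpk]].
    exact: connect0.
  rewrite rcons_path last_rcons size_rcons => /andP[vs eq_] qp ds.
  rewrite {}qp in eq_.
  have ds' : (d (last v s) <= size s)%N.
    by rewrite /d; case: ex_minnP => m _; apply; apply/asboolP; exists s.
  have dlt : (d (last v s) < d p)%N by rewrite -ds.
  apply: (connect_trans (IH _ (leq_trans dlt dpk))).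
  by apply: connect1; rewrite /= eq_ dlt.
Qed.

(* [u] is taken with as few ancestors as possible, so that it is connected to
   each of its ancestors. *)
Lemma disjoint_ancestors (T : finType) (e : rel T) (x0 : T) :
  ~ (exists v, forall p, connect e v p) ->
  exists u v, forall q, connect e q u -> ~~ connect e q v.
Proof.
move=> noroot.
pose anc v := [set q | connect e q v].
case: (arg_minnP (fun v => #|[set q | connect e q v]%SET|) (erefl (x0 \in T))).
move=> u _ umin; have /existsNP[v /negP uv] : ~ forall p, connect e u p.
  by move=> up; apply: noroot; exists u.
exists u, v => q qu; apply: contra uv => qv; apply: connect_trans _ qv.
have /eqP ancE : [set z | connect e z q]%SET == [set z | connect e z u]%SET.
  rewrite eqEcard umin // andbT; apply/fintype.subsetP => z.
  by rewrite !inE => zq; exact: connect_trans zq qu.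
by move/setP/(_ u): ancE; rewrite !inE connect0.
Qed.

(** * Equilibria of matrices without a root *)

(* Replacing the rows outside [I] by rows of the identity gives a matrix that
   annihilates the indicator vector of [I]. *)
Lemma closed_left_kernel (F : fieldType) (n : nat) (A : 'M[F]_n)
    (I : {set 'I_n}) (i0 : 'I_n) :
  (forall i, \sum_j A i j = 0) -> i0 \in I ->
  (forall i j, i \in I -> j \notin I -> A i j = 0) ->
  exists w : 'rV_n, [/\ w != 0, w *m A = 0 & forall j, j \notin I -> w 0 j = 0].
Proof.
move=> rowA i0I AI.
pose B := \matrix_(i, j) if i \in I then A i j else (i == j)%:R.
have : \det B == 0.
  rewrite -det_tr; apply/det0P; exists (\row_j (j \in I)%:R).
    apply/eqP => /rowP/(_ i0); rewrite !mxE i0I => /eqP.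
    by rewrite oner_eq0.
  apply/rowP => i; rewrite !mxE; have [iI|iI] := boolP (i \in I).
    rewrite -[RHS](rowA i); apply: eq_bigr => j _; rewrite !mxE iI.
    by have [jI|/(AI i j iI)->] := boolP (j \in I); rewrite ?mul1r ?mulr0.
  apply: big1 => j _; rewrite !mxE (negPf iI).
  by have [<-|_] := eqVneq i j; rewrite ?mulr0 // (negPf iI) mul0r.
case/det0P => w w0 wB; have wI j : j \notin I -> w 0 j = 0.
  move=> jI; move/rowP/(_ j): wB; rewrite !mxE (bigD1 j) //= big1.
    by rewrite !mxE (negPf jI) eqxx mulr1 addr0.
  move=> i ij; rewrite !mxE (negPf ij); have [iI|_] := boolP (i \in I).
    by rewrite (AI i j) // mulr0.
  by rewrite mulr0.
exists w; split=> //; rewrite -wB; apply/rowP => j; rewrite !mxE.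
apply: eq_bigr => i _; rewrite !mxE.
by have [//|/wI->] := boolP (i \in I); rewrite !mul0r.
Qed.

(** Disjoint supports make [u] and [v] independent. As [A] is square, its right kernel also has
    dimension at least 2 and cannot fit in the line of constant vectors. *)
Lemma left_kernel_nonconst (F : fieldType) (n : nat) (A : 'M[F]_n)
    (u v : 'rV[F]_n) :
  u != 0 -> v != 0 -> u *m A = 0 -> v *m A = 0 ->
  (forall j, u 0 j = 0 \/ v 0 j = 0) ->
  exists2 x : 'cV_n, A *m x = 0 & forall c, x <> const_mx c.
Proof.
move=> u0 v0 uA vA uv.
have rank2 : (1 < \rank (kermx A))%N.
  have <- : \rank (col_mx u v) = 2%N.
    apply/eqP; rewrite -[_ == _]/(row_free _).
    apply: inj_row_free => w; rewrite -[w]hsubmxK mul_row_col.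
    rewrite [lsubmx w]mx11_scalar [rsubmx w]mx11_scalar !mul_scalar_mx.
    set a := lsubmx w 0 0; set b := rsubmx w 0 0 => /rowP auv.
    have /rV0Pn[j uj] := u0; have /rV0Pn[k vk] := v0.
    have a0 : a = 0.
      have := auv j; rewrite !mxE; case: (uv j) => [/eqP|->].
        by rewrite (negPf uj).
      by rewrite mulr0 addr0 => /eqP; rewrite mulf_eq0 (negPf uj) orbF => /eqP.
    have b0 : b = 0.
      have := auv k; rewrite !mxE; case: (uv k) => [->|/eqP].
        by rewrite mulr0 add0r => /eqP; rewrite mulf_eq0 (negPf vk) orbF => /eqP.
      by rewrite (negPf vk).
    by rewrite a0 b0 !raddf0 row_mx0.
  by apply: mxrankS; rewrite col_mx_sub !sub_kermx uA vA eqxx.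
have : ~~ (kermx A^T <= (const_mx 1 : 'rV_n))%MS.
  apply/negP => /mxrankS; rewrite mxrank_ker mxrank_tr -mxrank_ker.
  by move=> /leq_trans/(_ (rank_leq_row _)); rewrite leqNgt rank2.
case/row_subPn => i Ki; exists (row i (kermx A^T))^T.
  apply: trmx_inj; rewrite trmx_mul trmxK trmx0.
  by apply/sub_kermxP; exact: row_sub.
move=> c /(congr1 trmx); rewrite trmxK => Kc.
move/negP: Ki; apply; rewrite Kc; apply/sub_rVP; exists c.
by apply/rowP => j; rewrite !mxE mulr1.
Qed.

Lemma UCC_kernel (R : realType) (n : nat) (A1 A2 : 'M[R]_n.+1) (b : bool)
    (x0 : 'cV[R]_n.+1) :
  UCC A1 A2 -> mode A1 A2 b *m x0 = 0 -> exists c, x0 = const_mx c.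
Proof.
move=> ucc Ax0.
have law : switching_law (fun=> b : bool) (R := R).
  move=> T; apply: (sub_finite_set _ (finite_set0 R)) => t [_]; apply.
  exact: cvg_cst.
have sol : solution A1 A2 (fun=> b) x0 (fun=> x0).
  split=> //; first by move=> x; exact: cvg_cst.
  by move=> t _ _; rewrite Ax0; exact: is_derive_cst.
have [c xc] := ucc _ law _ _ sol; exists c.
by apply: (cvg_unique (@norm_hausdorff R _) _ xc); exact: cvg_cst.
Qed.

Lemma UCC_mode_rooted (R : realType) (n : nat) (A1 A2 : 'M[R]_n.+1) (b : bool) :
  UCC A1 A2 -> zero_row_sums (mode A1 A2 b) ->
  exists v, forall p, connect (digraph (mode A1 A2 b)) v p.
Proof.
set A := mode A1 A2 b => ucc rowA; apply: contrapT => /(disjoint_ancestors ord0).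
move=> [u [v uv]].
(* A nonzero [A i j] with [j != i] is an edge from [j] to [i], so it makes [j] an ancestor as
   well. *)
have anc_closed (r i j : 'I_n.+1) : i \in [set q | connect (digraph A) q r]%SET ->
    j \notin [set q | connect (digraph A) q r]%SET -> A i j = 0.
  rewrite !inE => ir; apply: contraNeq => Aij; apply: connect_trans ir.
  have [->|ji] := eqVneq j i; first exact: connect0.
  by apply: connect1; rewrite /digraph ji.
have self r : r \in [set q | connect (digraph A) q r]%SET by rewrite inE connect0.
have [y [y0 yA yu]] := closed_left_kernel rowA (self u) (@anc_closed u).
have [z [z0 zA zv]] := closed_left_kernel rowA (self v) (@anc_closed v).
have [|x Ax xc] := left_kernel_nonconst y0 z0 yA zA.
  move=> j; have [ju|ju] := boolP (connect (digraph A) j u).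
    by right; apply: zv; rewrite inE uv.
  by left; apply: yu; rewrite inE.
by have [c] := UCC_kernel ucc Ax; exact: xc.
Qed.

(** * Nonnegative trajectories *)

Section Monotone.
Variable R : realType.
Implicit Types (f : R -> R) (E : set R).

(** Each exceptional point inside the interval splits it in two; continuity glues the
    inequalities. *)
Lemma nonneg_derive_le_seq f (s : seq R) (a b : R) :
  a <= b -> {within `[a, b], continuous f} ->
  (forall t, t \in `]a, b[ -> t \notin s ->
     exists2 d, is_derive t 1 f d & 0 <= d) ->
  f a <= f b.
Proof.
elim: s a b => [|c s IH] a b ab fc fd.
  have fd' t : t \in `]a, b[ -> derivable f t 1 /\ 0 <= derive1 f t.
    by move=> /fd/(_ isT)[d [? fE]] d0; split; rewrite // derive1E fE.
  apply: (ger0_derive1_le_cc (fun t h => (fd' t h).1) (fun t h => (fd' t h).2))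
    => //; by rewrite in_itv/= lexx ab.
have [cab|cab] := boolP (c \in `]a, b[); last first.
  apply: IH => // t tab ts; apply: fd => //; rewrite inE negb_or ts andbT.
  by apply: contraNneq cab => <-.
have /andP[ac cb] : a < c < b by move: cab; rewrite in_itv.
apply: (@le_trans _ _ (f c)); apply: IH; rewrite ?ltW //.
- apply: continuous_subspaceW fc; apply: subset_itvl; exact: ltW.
- move=> t; rewrite in_itv /= => /andP[at_ tc] ts; apply: fd.
    by rewrite in_itv /= at_ (lt_trans tc).
  by rewrite inE negb_or ts (lt_eqF tc).
- apply: continuous_subspaceW fc; apply: subset_itvr; exact: ltW.
- move=> t; rewrite in_itv /= => /andP[ct tb] ts; apply: fd.
    by rewrite in_itv /= tb (lt_trans ac).
  by rewrite inE negb_or ts (gt_eqF ct).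
Qed.

Lemma nonneg_derive_le f (P : R -> Prop) (a b : R) :
  a <= b -> {within `[a, b], continuous f} ->
  finite_set [set t | t \in `[a, b] /\ ~ P t] ->
  (forall t, t \in `]a, b[ -> P t -> exists2 d, is_derive t 1 f d & 0 <= d) ->
  f a <= f b.
Proof.
move=> ab fc /finite_seqP[s Es] fd.
apply: (nonneg_derive_le_seq ab fc (s := s)) => t tab ts; apply: fd => //.
apply: contrapT => Pt; move/negP: ts; apply.
have : [set` s] t by rewrite -Es /=; split=> //; exact: subset_itv_oo_cc tab.
by [].
Qed.

Lemma continuous_mulrl (c : R) : continuous (fun u : R => c * u).
Proof. by move=> u; apply: cvgM; [exact: cvg_cst|exact: cvg_id]. Qed.

Lemma continuous_expRM (c : R) : continuous (fun u : R => expR (c * u)).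
Proof.
move=> u; apply: (continuous_comp (continuous_mulrl (c := c) (x := u))).
exact: continuous_expR.
Qed.

End Monotone.

Section Trajectories.
Variables (R : realType) (n : nat) (A1 A2 : 'M[R]_n) (sigma : R -> bool).
Variable L : R.
Hypothesis metz : forall b, metzler (mode A1 A2 b).
Hypothesis rows : forall b, zero_row_sums (mode A1 A2 b).
Hypothesis diag_ge : forall b i, - L <= mode A1 A2 b i i.
Hypothesis law : switching_law sigma.

Implicit Types (y z : 'I_n -> R -> R) (s t : R).

Definition trajectory y := forall i,
  {within `[0, +oo[, continuous (y i)} /\
  forall t, 0 < t -> switching_continuous_at sigma t ->
    is_derive t 1 (y i) (\sum_j mode A1 A2 (sigma t) i j * y j t).

(* The matrix [L + mode b] is nonnegative with row sums [L]. *)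
Lemma shifted_row_ge b (v : 'I_n -> R) (m : R) i :
  (forall j, m <= v j) -> L * m <= L * v i + \sum_j mode A1 A2 b i j * v j.
Proof.
move=> mv; have -> : \sum_j mode A1 A2 b i j * v j =
    \sum_j mode A1 A2 b i j * (v j - m).
  under [RHS]eq_bigr do rewrite mulrBr.
  by rewrite sumrB -mulr_suml rows mul0r subr0.
rewrite (bigD1 i) //= addrA -lerBlDl.
have le0 : L * m - (L * v i + mode A1 A2 b i i * (v i - m)) <= 0.
  have := mulr_ge0 (_ : 0 <= L + mode A1 A2 b i i) (_ : 0 <= v i - m).
  rewrite subr_ge0 mv -lerBlDl sub0r diag_ge => /(_ isT isT); nra.
apply: le_trans le0 (sumr_ge0 _ _) => j ji.
by rewrite mulr_ge0 ?subr_ge0 // metz // eq_sym.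
Qed.

(** All terms of the row of [L + mode b] are nonnegative; only the one of the edge is kept. *)
Lemma shifted_row_edge b (v : 'I_n -> R) i k :
  (forall j, 0 <= v j) -> i != k ->
  mode A1 A2 b i k * v k <= L * v i + \sum_j mode A1 A2 b i j * v j.
Proof.
move=> v0 ik; rewrite (bigD1 i) //= (bigD1 k) 1?eq_sym //=.
rewrite addrA -mulrDl addrCA lerDl addr_ge0 ?mulr_ge0 //.
  by rewrite -lerBlDl sub0r.
by apply: sumr_ge0 => j /andP[ji _]; rewrite mulr_ge0 // metz // eq_sym.
Qed.

(** The integrating factor replaces [mode b] by the nonnegative matrix [L + mode b] in the
    derivative. *)
Definition growth y i t := expR (L * t) * y i t.

Lemma growth_derive y i t : trajectory y -> 0 < t ->
  switching_continuous_at sigma t ->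
  is_derive t 1 (growth y i)
    (expR (L * t) * (L * y i t + \sum_j mode A1 A2 (sigma t) i j * y j t)).
Proof.
move=> ty t0 ct; have := (ty i).2 t t0 ct => dy.
rewrite /growth; apply: is_derive_eq; rewrite /= !scaler1 /GRing.scale /=.
ring.
Qed.

Lemma growth_continuous y i s t : trajectory y -> 0 <= s ->
  {within `[s, t], continuous (growth y i)}.
Proof.
move=> ty s0; rewrite /growth => x; apply: cvgM.
  exact: (continuous_subspaceT (@continuous_expRM _ _)).
apply: continuous_subspaceW (ty i).1 x => u /=.
by rewrite !in_itv /= andbT => /andP[/(le_trans s0)].
Qed.

Lemma le_of_derive_switching (f : R -> R) s t : 0 <= s -> s <= t ->
  {within `[s, t], continuous f} ->
  (forall u, s < u < t -> switching_continuous_at sigma u ->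
     exists2 d, is_derive u 1 f d & 0 <= d) ->
  f s <= f t.
Proof.
move=> s0 st fc fd.
apply: (@nonneg_derive_le _ f (switching_continuous_at sigma)) => //.
  apply: sub_finite_set (law t) => u [] /=; rewrite !in_itv /= => /andP[su ut].
  by rewrite ut (le_trans s0).
Qed.

(* At a negative minimum [mu] of [expR (- L * u) * y i u] over all [i] and all
   [u] in [s, t], the derivative bound [L * mu * expR (2 * L * u)] on
   [growth y i] integrates to only half of what is needed to reach [mu]. *)
Lemma trajectory_ge0 y s t : trajectory y -> 0 <= s -> s <= t ->
  (forall i, 0 <= y i s) -> forall i, 0 <= y i t.
Proof.
move=> ty s0 st ys i0.
pose g i u := expR (- L * u) * y i u.
have gc i : {within `[s, t], continuous (g i)}.
  move=> x; apply: cvgM.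
    exact: (continuous_subspaceT (@continuous_expRM _ _)).
  apply: continuous_subspaceW (ty i).1 x => u /=.
  by rewrite !in_itv /= andbT => /andP[/(le_trans s0)].
have gmin i : {c | c \in `[s, t] & forall u, u \in `[s, t] -> g i c <= g i u}.
  by apply/cid2; exact: EVT_min.
pose tm i := s2val (gmin i).
have [i _ imin] := arg_minP (fun i => g i (tm i)) (erefl (i0 \in 'I_n)).
have tmst : tm i \in `[s, t] by rewrite /tm; case: (gmin i).
set mu := g i (tm i) in imin.
have mu_le j u : u \in `[s, t] -> mu <= g j u.
  move=> ust; apply: le_trans (imin j isT) _.
  by rewrite /tm; case: (gmin j) => /= c _; apply.
have yE j u : y j u = expR (L * u) * g j u.
  by rewrite /g mulrA -expRD mulNr addrN expR0 mul1r.
suff mu0 : 0 <= mu.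
  rewrite yE mulr_ge0 ?expR_ge0 // (le_trans mu0) // mu_le //.
  by rewrite in_itv /= st lexx.
rewrite leNgt; apply/negP => mu0.
move: tmst; rewrite in_itv /= => /andP[stm tmt].
pose f u := growth y i u - mu / 2 * expR (2 * L * u).
have fle : f s <= f (tm i).
  apply: le_of_derive_switching => //.
    move=> x; apply: cvgB; first exact: growth_continuous.
    apply: cvgM; first exact: cvg_cst.
    exact: (continuous_subspaceT (@continuous_expRM _ _)).
  move=> u /andP[su utm] cu; have u0 := le_lt_trans s0 su.
  have dg := growth_derive i ty u0 cu.
  have df : is_derive u 1 f (expR (L * u) *
      (L * y i u + \sum_j mode A1 A2 (sigma u) i j * y j u) -
      mu * L * expR (2 * L * u)).
    rewrite /f; apply: is_derive_eq; rewrite /= !scaler1 /GRing.scale /=.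
    by field.
  eexists; first exact: df.
  have /(@shifted_row_ge (sigma u) (y ^~ u) _ i) :
      forall j, expR (L * u) * mu <= y j u.
    move=> j; rewrite yE ler_pM2l ?expR_gt0 // mu_le //.
    by rewrite in_itv /= !ltW // (lt_le_trans utm).
  rewrite -(ler_pM2l (expR_gt0 (L * u))) subr_ge0; apply: le_trans.
  rewrite (_ : 2 * L * u = L * u + L * u) ?expRD; last by ring.
  by rewrite le_eqVlt; apply/orP; left; apply/eqP; ring.
have gs : 0 <= growth y i s by rewrite mulr_ge0 ?expR_ge0.
have gt : growth y i (tm i) = expR (2 * L * tm i) * mu.
  rewrite /growth yE mulrA -expRD; congr (expR _ * _); ring.
(* Since [mu < 0], [f s] is positive, whereas [f (tm i)] equals [mu / 2 * expR (2 * L * tm i)],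
   which is negative. *)
move: fle; rewrite /f gt.
have := expR_gt0 (2 * L * s); have := expR_gt0 (2 * L * tm i).
nra.
Qed.

Lemma growth_nondecreasing y i s t : trajectory y -> 0 <= s -> s <= t ->
  (forall j, 0 <= y j s) -> growth y i s <= growth y i t.
Proof.
move=> ty s0 st ys; apply: le_of_derive_switching => //.
  exact: growth_continuous.
move=> u /andP[su _] cu; have u0 := le_lt_trans s0 su.
eexists; first exact: growth_derive.
rewrite mulr_ge0 ?expR_ge0 //.
have := @shifted_row_ge (sigma u) (y ^~ u) 0 i; rewrite mulr0; apply => j.
exact: trajectory_ge0 ty s0 (ltW su) ys j.
Qed.

(* Whichever mode is active, the derivative of one of the two summands is large
   enough; so the time spent in each mode need not be measured. *)
Lemma growth_pair y z (k d s : R) (i1 j1 i2 j2 : 'I_n) :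
  trajectory y -> trajectory z -> 0 <= s ->
  (forall j, 0 <= y j s) -> (forall j, 0 <= z j s) ->
  i1 != j1 -> i2 != j2 -> 0 <= k -> k <= A1 i1 j1 -> k <= A2 i2 j2 ->
  0 <= d -> d <= y j1 s -> d <= z j2 s ->
  k * d <= expR L * (y i1 (s + 1) + z i2 (s + 1)).
Proof.
move=> ty tz s0 ys zs ij1 ij2 k0 k1 k2 d0 dy dz.
have s1 : s <= s + 1 by rewrite lerDl.
(* The subtracted slope is a lower bound, in either mode, for the derivative of the sum of the two
   growths. *)
pose f u := growth y i1 u + growth z i2 u - k * d * expR (L * s) * u.
have fle : f s <= f (s + 1).
  apply: le_of_derive_switching => //.
    move=> x; apply: cvgB.
      by apply: cvgD; exact: growth_continuous.
    exact: (continuous_subspaceT (@continuous_mulrl _ _)).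
  move=> u /andP[su _] cu; have u0 := le_lt_trans s0 su.
  have dgy := growth_derive i1 ty u0 cu.
  have dgz := growth_derive i2 tz u0 cu.
  have df : is_derive u 1 f
      (expR (L * u) * (L * y i1 u + \sum_j mode A1 A2 (sigma u) i1 j * y j u) +
       expR (L * u) * (L * z i2 u + \sum_j mode A1 A2 (sigma u) i2 j * z j u) -
       k * d * expR (L * s)).
    rewrite /f; apply: is_derive_eq; rewrite /= !scaler1 /GRing.scale /=.
    ring.
  eexists; first exact: df.
  have yu j : 0 <= y j u := trajectory_ge0 ty s0 (ltW su) ys j.
  have zu j : 0 <= z j u := trajectory_ge0 tz s0 (ltW su) zs j.
  have Y := @shifted_row_edge (sigma u) (y ^~ u) i1 j1 yu ij1.
  have Z := @shifted_row_edge (sigma u) (z ^~ u) i2 j2 zu ij2.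
  have Y0 := @shifted_row_ge (sigma u) (y ^~ u) 0 i1 yu.
  have Z0 := @shifted_row_ge (sigma u) (z ^~ u) 0 i2 zu.
  have gy := growth_nondecreasing j1 ty s0 (ltW su) ys.
  have gz := growth_nondecreasing j2 tz s0 (ltW su) zs.
  (* The source of the edge was at least [d] at time [s], and its growth has not decreased since. *)
  have aux (a w v : R) : 0 <= v -> k <= a -> d <= w ->
      expR (L * s) * w <= expR (L * u) * v ->
      k * d * expR (L * s) <= expR (L * u) * (a * v).
    move=> v0 ka dw wv.
    rewrite mulrCA -mulrA; apply: ler_pM => //.
      by rewrite mulr_ge0 ?expR_ge0.
    by apply: le_trans wv; rewrite mulrC ler_pM2l ?expR_gt0.
  move: Y0 Z0; rewrite mulr0 => Y0 Z0.
  rewrite subr_ge0; case: (sigma u) Y Z Y0 Z0 => /= Y Z Y0 Z0.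
    apply: (@le_trans _ _ (expR (L * u) * (A1 i1 j1 * y j1 u))).
      exact: aux gy.
    by rewrite -[leLHS]addr0 lerD ?ler_pM2l ?expR_gt0 ?mulr_ge0 ?expR_ge0.
  apply: (@le_trans _ _ (expR (L * u) * (A2 i2 j2 * z j2 u))).
    exact: aux gz.
  by rewrite -[leLHS]add0r lerD ?ler_pM2l ?expR_gt0 ?mulr_ge0 ?expR_ge0.
have gy0 : 0 <= growth y i1 s by rewrite mulr_ge0 ?expR_ge0.
have gz0 : 0 <= growth z i2 s by rewrite mulr_ge0 ?expR_ge0.
rewrite -(ler_pM2l (expR_gt0 (L * s))).
move: fle; rewrite /f /growth mulrDr mulr1 expRD => fle.
move: gy0 gz0; rewrite /growth => gy0 gz0.
lra.
Qed.

End Trajectories.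

(** * Contraction of the spread *)

Lemma connect_escape (T : finType) (e : rel T) (X : pred T) (v p : T) :
  connect e v p -> X v -> ~~ X p -> exists i j, [/\ e i j, X i & ~~ X j].
Proof.
case/connectP => s; elim: s v => [v _ -> Xv /negP//|w s IH v /= /andP[vw ws] ps].
move=> Xv Xp; have [Xw|Xw] := boolP (X w); first exact: IH ws ps Xw Xp.
by exists v, w.
Qed.

Section Contraction.
Variables (R : realType) (n : nat) (A1 A2 : 'M[R]_n) (sigma : R -> bool).
Variables L k : R.
Hypothesis metz : forall b, metzler (mode A1 A2 b).
Hypothesis rows : forall b, zero_row_sums (mode A1 A2 b).
Hypothesis rooted :
  forall b, exists v, forall p, connect (digraph (mode A1 A2 b)) v p.
Hypothesis L_gt0 : 0 < L.
Hypothesis diag_ge : forall b i, - L <= mode A1 A2 b i i.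
Hypothesis k_gt0 : 0 < k.
Hypothesis k_le1 : k <= 1.
Hypothesis k_le :
  forall b i j, 0 < mode A1 A2 b i j -> k <= mode A1 A2 b i j.
Hypothesis law : switching_law sigma.

Local Notation trajectory := (trajectory A1 A2 sigma).

(* [k / 2]: in [growth_pair] at least one of the two summands gets half. *)
Let c := expR (- L) * (k / 2).

Let c_gt0 : 0 < c.
Proof. by rewrite mulr_gt0 ?expR_gt0 ?divr_gt0. Qed.

Let c_le : c <= expR (- L).
Proof.
by rewrite ler_piMr ?expR_ge0 // ler_pdivrMr // mul1r (le_trans k_le1) ?ler1n.
Qed.

(** Monotone growth limits the decay per time unit to the factor [expR (- L)], which is at least
    [c]. So large components stay large when the threshold shrinks by [c]. *)
Lemma trajectory_decay (y : 'I_n -> R -> R) (s : R) m i : trajectory y ->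
  0 <= s -> (forall j, 0 <= y j s) -> c ^+ m * y i s <= y i (s + m%:R).
Proof.
move=> ty s0 ys; have sm : s <= s + m%:R by rewrite lerDl.
apply: (@le_trans _ _ (expR (- L * m%:R) * y i s)).
  rewrite ler_wpM2r // mulrC expRM_natl lerXn2r ?nnegrE ?expR_ge0 //.
  exact: ltW.
have := growth_nondecreasing metz rows diag_ge law i ty s0 sm ys.
rewrite /growth mulrDr expRD -mulrA ler_pM2l ?expR_gt0 // mulNr expRN.
by rewrite ler_pdivrMl ?expR_gt0.
Qed.

Definition level (y : bool -> 'I_n -> R -> R) (s d : R) : {set bool * 'I_n} :=
  [set bi : bool * 'I_n | d <= y bi.1 bi.2 s]%SET.

Variable y : bool -> 'I_n -> R -> R.
Hypothesis ty : forall b, trajectory (y b).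
Variable D : R.
Hypothesis y_sum : forall i t, y true i t + y false i t = D.

(* Both families cover all agents, so each mode's root lies in the level set of
   one of them; if neither level set is full, an edge leaves it. *)
Lemma level_grows (s d : R) : 0 <= s -> (forall b i, 0 <= y b i s) ->
  0 <= d -> d <= D / 2 ->
  (exists b, forall i, d <= y b i s) \/
  (#|level y s d| < #|level y (s + 1) (c * d)|)%N.
Proof.
move=> s0 ys d0 dD; have [?|nofull] :=
  pselect (exists b, forall i, d <= y b i s); [by left|right].
have escape b : exists a i j,
    [/\ i != j, k <= mode A1 A2 b i j, d <= y a j s & ~~ (d <= y a i s)].
  have [v rv] := rooted b.
  have [a av] : exists a, d <= y a v s.
    have := y_sum v s; have [ds|sd] := leP d (y true v s).
      by exists true.
    by exists false; lra.
  have /existsNP[p /negP pa] : ~ forall i, d <= y a i s.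
    by move=> ?; apply: nofull; exists a.
  have [j [i [/andP[ji Aij] ja ia]]] :=
    @connect_escape _ _ (fun i => d <= y a i s) _ _ (rv p) av pa.
  exists a, i, j; split=> //; first by rewrite eq_sym.
  by rewrite k_le // lt_neqAle eq_sym Aij metz // eq_sym.
have [a1 [i1 [j1 [ij1 k1 yj1 yi1]]]] := escape true.
have [a2 [i2 [j2 [ij2 k2 yj2 yi2]]]] := escape false.
have sub : level y s d \subset level y (s + 1) (c * d).
  apply/fintype.subsetP => -[b i]; rewrite !inE /= => dy.
  apply: le_trans (trajectory_decay 1 i (ty b) s0 (ys b)).
  by rewrite expr1 ler_pM2l.
(* Without a new element, both edge targets stay below [c * d], so their sum is below
   [2 * c * d = expR (- L) * k * d], against [growth_pair]. *)
apply: proper_card; rewrite properE sub /=; apply/negP => /fintype.subsetP sup.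
have pair := growth_pair metz rows diag_ge law (ty a1) (ty a2) s0 (ys a1)
  (ys a2) ij1 ij2 (ltW k_gt0) k1 k2 d0 yj1 yj2.
have small a i : ~~ (d <= y a i s) -> y a i (s + 1) < c * d.
  rewrite ltNge; apply: contra => cdy.
  by have := sup (a, i); rewrite !inE /=; exact.
have := ltrD (small _ _ yi1) (small _ _ yi2).
rewrite ltNge => /negP; apply.
rewrite -(ler_pM2l (expR_gt0 L)) (le_trans _ pair) //.
rewrite /c expRN le_eqVlt; apply/orP; left; apply/eqP.
by have := expR_gt0 L; move=> /lt0r_neq0 e0; field.
Qed.

(** Here [m] is the number of time units left. At [m = 0] the cardinality hypothesis is absurd, as
    there are only [2 * n] pairs of a family and a node. *)
Lemma level_full m (s d : R) : 0 <= s -> (forall b i, 0 <= y b i s) ->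
  0 <= d -> d <= D / 2 -> (2 * n < #|level y s d| + m)%N ->
  exists b, forall i, c ^+ m * d <= y b i (s + m%:R).
Proof.
elim: m s d => [|m IH] s d s0 ys d0 dD card.
  have := max_card (level y s d); rewrite card_prod card_bool card_ord.
  by rewrite leqNgt -[#|level y s d|]addn0 card.
have [[b yb]|grow] := level_grows s0 ys d0 dD.
  exists b => i; apply: le_trans (trajectory_decay m.+1 i (ty b) s0 (ys b)).
  by rewrite ler_pM2l ?exprn_gt0.
rewrite exprSr -mulrA -natr1 [_ + 1]addrC addrA; apply: IH.
- by rewrite addr_ge0.
- move=> b i; apply: le_trans (trajectory_decay 1 i (ty b) s0 (ys b)).
  by apply: mulr_ge0 => //; apply: exprn_ge0; exact: ltW.
- by apply: mulr_ge0 => //; exact: ltW.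
- apply: le_trans dD; rewrite ler_piMl // (le_trans c_le) // expR_le1.
  by rewrite oppr_le0 ltW.
- by rewrite (leq_trans card) // addnS -addSn leq_add2r.
Qed.

End Contraction.

(** Zero row sums annihilate the constant [b]. This yields the families [x - lo] and [hi - x]. *)
Lemma trajectory_affine (R : realType) (n : nat) (A1 A2 : 'M[R]_n)
    (sigma : R -> bool) (x : 'I_n -> R -> R) (a b : R) :
  (forall m, zero_row_sums (mode A1 A2 m)) -> trajectory A1 A2 sigma x ->
  trajectory A1 A2 sigma (fun i t => a * x i t + b).
Proof.
move=> rows tx i; have [xc dx] := tx i; split.
  move=> t; apply: cvgD; last exact: cvg_cst.
  by apply: cvgM; [exact: cvg_cst|exact: xc].
move=> t t0 ct; have := dx t t0 ct => dxt.
apply: is_derive_eq; rewrite addr0 /GRing.scale /=.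
under [RHS]eq_bigr do rewrite mulrDr mulrCA.
by rewrite big_split /= -mulr_suml rows mul0r addr0 -mulr_sumr.
Qed.

Lemma trajectory_contraction (R : realType) (n : nat) (A1 A2 : 'M[R]_n) :
  (forall b, metzler (mode A1 A2 b)) ->
  (forall b, zero_row_sums (mode A1 A2 b)) ->
  (forall b, exists v, forall p, connect (digraph (mode A1 A2 b)) v p) ->
  exists r N : R, [/\ 0 <= r < 1, 0 <= N &
    forall sigma x, switching_law sigma -> trajectory A1 A2 sigma x ->
    forall s lo hi, 0 <= s -> (forall i, lo <= x i s <= hi) ->
    exists lo' hi', hi' - lo' = r * (hi - lo) /\
      forall t, s + N <= t -> forall i, lo' <= x i t <= hi'].
Proof.
move=> metz rows rooted.
pose L := 1 + \sum_b \sum_i `|mode A1 A2 b i i|.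
have L0 : 0 < L by rewrite ltr_wpDr ?ltr01 // sumr_ge0 // => b _; exact: sumr_ge0.
have diagL b i : - L <= mode A1 A2 b i i.
  rewrite lerNl; apply: le_trans (ler_norm _) _; rewrite normrN /L.
  rewrite (bigD1 b) //= (bigD1 i) //= -!addrA [leRHS]addrCA lerDl.
  rewrite addr_ge0 ?addr_ge0 ?sumr_ge0 // => a _; exact: sumr_ge0.
pose entry (z : bool * ('I_n * 'I_n)) := mode A1 A2 z.1 z.2.1 z.2.2.
(* The least positive entry of the two matrices, capped at 1. *)
pose k := \big[Order.min/1]_(z | 0 < entry z) entry z.
have k0 : 0 < k by exact: lt_bigmin.
have k1 : k <= 1 by exact: bigmin_le_id.
have kle b i j : 0 < mode A1 A2 b i j -> k <= mode A1 A2 b i j.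
  by move=> pos; exact: (@bigmin_le_cond _ _ _ _ (b, (i, j)) (fun z => 0 < entry z)).
pose c := expR (- L) * (k / 2).
(* Enough time units for [level_full] even if the initial level set were empty. *)
pose m := (2 * n).+1.
have c0 : 0 < c by rewrite mulr_gt0 ?expR_gt0 ?divr_gt0.
have c1 : c <= 1.
  have : expR (- L) <= 1 by rewrite expR_le1 oppr_le0 ltW.
  have := expR_gt0 (- L); rewrite /c; nra.
have cm0 : 0 < c ^+ m by exact: exprn_gt0.
have cm1 : c ^+ m <= 1 by rewrite exprn_ile1 // ltW.
(* With the initial threshold [(hi - lo) / 2], one of the two bounds moves inwards by
   [c ^+ m * ((hi - lo) / 2)]. *)
exists (1 - c ^+ m / 2), m%:R; split; [lra|by []|].
move=> sigma x law tx s lo hi s0 xs.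
pose y (b : bool) i t := (if b then 1 else -1) * x i t + (if b then - lo else hi).
have ty b : trajectory A1 A2 sigma (y b) by exact: trajectory_affine.
have ys b i : 0 <= y b i s by rewrite /y; have /andP[] := xs i; case: b => ? ?; lra.
have ysum i t : y true i t + y false i t = hi - lo by rewrite /y; ring.
have D0 : 0 <= hi - lo.
  by have [v _] := rooted true; rewrite -(ysum v s) addr_ge0.
have [|b yb] := level_full metz rows rooted L0 diagL k0 k1 kle law ty ysum
    (m := m) s0 ys (divr_ge0 D0 (ler0n _ 2)) (lexx _).
  by rewrite /m addnS ltnS leq_addl.
rewrite -/c in yb.
have sm : 0 <= s + m%:R by rewrite addr_ge0.
have low lo' u t : 0 <= u -> u <= t -> (forall i, lo' <= x i u) ->
    forall i, lo' <= x i t.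
  move=> u0 ut xu i.
  have := trajectory_ge0 metz rows diagL law
    (trajectory_affine 1 (- lo') rows tx) u0 ut.
  by move=> /(_ _ i); rewrite mul1r subr_ge0; apply => j; rewrite mul1r subr_ge0.
have high hi' u t : 0 <= u -> u <= t -> (forall i, x i u <= hi') ->
    forall i, x i t <= hi'.
  move=> u0 ut xu i.
  have := trajectory_ge0 metz rows diagL law
    (trajectory_affine (-1) hi' rows tx) u0 ut.
  move=> /(_ _ i); rewrite mulN1r addrC subr_ge0; apply => j.
  by rewrite mulN1r addrC subr_ge0.
have s_le t : s + m%:R <= t -> s <= t by apply: le_trans; rewrite lerDl.
(* If [x - lo] is large everywhere, the lower bound rises; if [hi - x] is, the upper bound drops. *)
case: b yb => yb.
  exists (lo + c ^+ m * ((hi - lo) / 2)), hi; split; first by field.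
  move=> t st i; rewrite (low _ _ _ sm st) /=.
    by rewrite (high _ _ _ s0 (s_le t st)) // => j; have /andP[] := xs j.
  by move=> j; have := yb j; rewrite /y /=; lra.
exists lo, (hi - c ^+ m * ((hi - lo) / 2)); split; first by field.
move=> t st i; rewrite (low _ _ _ s0 (s_le t st)) /=.
  by rewrite (high _ _ _ sm st) // => j; have := yb j; rewrite /y /=; lra.
by move=> j; have /andP[] := xs j.
Qed.

Lemma reaches_consensus_contraction (R : realType) (n : nat)
    (x : R -> 'cV[R]_n.+1) (r N : R) :
  0 <= r < 1 -> 0 <= N ->
  (forall s lo hi, 0 <= s -> (forall i, lo <= x s i 0 <= hi) ->
    exists lo' hi', hi' - lo' = r * (hi - lo) /\
      forall t, s + N <= t -> forall i, lo' <= x t i 0 <= hi') ->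
  reaches_consensus x.
Proof.
move=> /andP[r0 r1] N0 contr.
pose K := \sum_i `|x 0 i 0|.
have xK i : - K <= x 0 i 0 <= K.
  rewrite -ler_norml /K (bigD1 i) //= lerDl; exact: sumr_ge0.
(* The exponent starts at 1 because [K] bounds [x] only at time 0; one use of [contr] makes the
   bounds hold at all later times. *)
have eventual k : exists T lo hi, [/\ 0 <= T, hi - lo = r ^+ k.+1 * (2 * K) &
    forall t, T <= t -> forall i, lo <= x t i 0 <= hi].
  elim: k => [|k [T [lo [hi [T0 lohi xT]]]]].
    have [lo [hi [lohi xN]]] := contr 0 (- K) K (lexx 0) xK.
    by exists (0 + N), lo, hi; rewrite addr_ge0 // lohi; split=> //; ring.
  have [lo' [hi' [lohi' xN]]] := contr T lo hi T0 (xT T (lexx T)).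
  exists (T + N), lo', hi'; rewrite addr_ge0 // lohi' lohi; split=> //.
  by rewrite [in RHS]exprS mulrA.
(* The limit is the supremum of the eventual lower bounds, which lies in every eventual interval
   [[lo, hi]]. *)
pose E := [set lo | exists T, forall t, T <= t -> forall i, lo <= x t i 0].
have Ele lo hi T : E lo -> (forall t, T <= t -> forall i, x t i 0 <= hi) ->
    lo <= hi.
  move=> [T' lox] xhi; pose u := Num.max T T'.
  apply: (@le_trans _ _ (x u ord0 0)).
    by apply: lox; rewrite le_max lexx orbT.
  by apply: xhi; rewrite le_max lexx.
exists (sup E); apply/cvgrPdist_le => e e0.
have [k ke] : exists k, r ^+ k.+1 * (2 * K) <= e.
  have : r ^+ k * (2 * K) @[k --> \oo] --> 0.
    rewrite -[X in _ --> X](mul0r (2 * K)); apply: cvgM; last exact: cvg_cst.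
    by apply: cvg_expr; rewrite ger0_norm.
  move/cvgrPdist_le/(_ e e0) => [k _ /(_ k.+1 (leqnSn k))] /=.
  by rewrite sub0r normrN => /ler_normlW; exists k.
have [T [lo [hi [T0 lohi xT]]]] := eventual k.
have Elo : E lo by exists T => t /xT h i; have /andP[] := h i.
have hiE : ubound E hi.
  by move=> z Ez; apply: (Ele z hi T) => // t /xT h i; have /andP[] := h i.
have lo_sup : lo <= sup E.
  by apply: sup_upper_bound => //; split; [exists lo|exists hi].
have sup_hi : sup E <= hi by apply: ge_sup => //; exists lo.
near=> t.
rewrite /Num.Def.normr /= mx_normrE (bigmax_le _ (ltW e0)) //= => -[i j] _.
have /xT/(_ i)/andP[] : T <= t by near: t; apply: nbhs_pinfty_ge; exact: num_real.
rewrite !mxE (ord1 j) /= ler_norml; lra.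
Unshelve. all: end_near.
Qed.

Lemma solution_trajectory (R : realType) (n : nat) (A1 A2 : 'M[R]_n.+1)
    (sigma : R -> bool) (x0 : 'cV[R]_n.+1) (x : R -> 'cV[R]_n.+1) :
  solution A1 A2 sigma x0 x -> trajectory A1 A2 sigma (fun i t => x t i 0).
Proof.
move=> [_ xc dx] i; split.
  move=> t; exact: cvg_comp (xc t) (@coord_continuous _ _ _ i 0 (x t)).
move=> t t0 ct; have [dxt xE] := dx t t0 ct.
split; first exact: (derivable_mxP x t 1).1 dxt i 0.
by have /matrixP/(_ i 0) := derive_mx dxt; rewrite xE !mxE.
Qed.

Lemma UCC_rooted (R : realType) (n : nat) (A1 A2 : 'M[R]_n.+1) :
  (forall b, metzler (mode A1 A2 b)) ->
  (forall b, zero_row_sums (mode A1 A2 b)) ->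
  (forall b, exists v, forall p, connect (digraph (mode A1 A2 b)) v p) ->
  UCC A1 A2.
Proof.
move=> metz rows rooted sigma law x0 x solx.
have [r [N [r01 N0 contr]]] := trajectory_contraction metz rows rooted.
apply: (reaches_consensus_contraction r01 N0) => s lo hi.
exact: contr law (solution_trajectory solx) s lo hi.
Qed.

(** * Convex combinations and the equivalence *)

Lemma has_rooted_out_branching_sub (T : finType) (e e' : rel T) :
  subrel e e' -> has_rooted_out_branching e -> has_rooted_out_branching e'.
Proof. by move=> ee' [b [be ? ?]]; exists b; split=> // x y /be/ee'. Qed.

Lemma digraph_addl (R : realType) (n : nat) (A B : 'M[R]_n) (a b : R) :
  metzler A -> metzler B -> 0 < a -> 0 <= b ->
  subrel (digraph A) (digraph (a *: A + b *: B)).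
Proof.
move=> mA mB a0 b0 i j /andP[ij Aji]; rewrite /digraph ij /= !mxE.
have ji : j != i by rewrite eq_sym.
rewrite lt0r_neq0 // ltr_wpDr ?mulr_ge0 ?mB // mulr_gt0 //.
by rewrite lt_neqAle eq_sym Aji mA.
Qed.

Theorem theorem2 (R : realType) (A1 A2 : 'M[R]_3)
    (metzler1 : metzler A1) (metzler2 : metzler A2)
    (rows1 : zero_row_sums A1) (rows2 : zero_row_sums A2) :
  UCC A1 A2 <->
  (forall A : 'M[R]_3, co A1 A2 A -> has_rooted_out_branching (digraph A)).
Proof.
have metz b : metzler (mode A1 A2 b) by case: b.
have rows b : zero_row_sums (mode A1 A2 b) by case: b.
split=> [ucc _ [a a01 <-]|rooted].
  have mode_rooted b : has_rooted_out_branching (digraph (mode A1 A2 b)).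
    by apply/has_rooted_out_branchingP; exact: UCC_mode_rooted.
  move: a01; rewrite /= in_itv /= => /andP[]; rewrite le_eqVlt.
  (* For [a = 0] the matrix is [A2]; for [a > 0] its digraph contains that of [A1]. *)
  case/predU1P=> [<- _|a0 a1].
    by rewrite scale0r add0r subr0 scale1r; exact: (mode_rooted false).
  apply: has_rooted_out_branching_sub (mode_rooted true).
  by apply: digraph_addl; rewrite ?subr_ge0.
apply: UCC_rooted => // b; apply/has_rooted_out_branchingP/rooted.
exists (if b then 1 else 0).
  by rewrite /= in_itv /=; case: b; rewrite ?lexx ?ler01.
by case: b; rewrite /mode ?subrr ?subr0 !scale1r scale0r ?addr0 ?add0r.
Qed.
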